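(* Let $a<b$ and let $f:[a,b]\to\mathbb{R}$ be twice continuously differentiable. For each integer $N\ge1$, let $T_{U,N}$ be the uniform partition of $[a,b]$ into $N$ subintervals of length $(b-a)/N$, and let $\pi_{T_{U,N}}f$ be the continuous piecewise linear interpolant of $f$ at the knots of $T_{U,N}$. Then $$\lim_{N\to\infty}N^2\,\bigl\|f-\pi_{T_{U,N}}f\bigr\|=\frac{(b-a)^2}{\sqrt{120}}\,\|f''\|.$$
   Context: $\|u\|=\bigl(\int_a^b u(x)^2\,dx\bigr)^{1/2}$ is the $L_2$ norm on $[a,b]$. The continuous piecewise linear interpolant of $f$ on a partition $a=x_0<\dots<x_N=b$ is the continuous function on $[a,b]$ that is affine on each $[x_{i-1},x_i]$ and equals $f(x_i)$ at each knot $x_i$. *)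

(* Defs.v *)
From Stdlib Require Import Reals Lra Lia.
From Coquelicot Require Import Coquelicot.
Open Scope R_scope.

(** Stdlib and Coquelicot reals.  A function on [a, b] is encoded as a total
    function [R -> R]; the notions below depend only on its values on [a, b]. *)

Definition cint (a b : R) : R -> Prop := fun x => a <= x <= b.

(** Limits are taken within [a, b] ([D_in], [continue_in]), so at [a] and [b]
    derivatives and continuity are one-sided.  For [a < b] the values of [f1]
    and [f2] on [a, b] are determined by [f]. *)
Definition C2_on (a b : R) (f f1 f2 : R -> R) : Prop :=
  forall x, a <= x <= b ->
    D_in f f1 (cint a b) x /\
    D_in f1 f2 (cint a b) x /\
    continue_in f2 (cint a b) x.

Definition L2norm (a b : R) (u : R -> R) : R :=
  sqrt (RInt (fun x => u x ^ 2) a b).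

(** Only [x 0], ..., [x N] matter. *)
Definition is_partition (a b : R) (N : nat) (x : nat -> R) : Prop :=
  x 0%nat = a /\ x N = b /\ forall i, (i < N)%nat -> x i < x (S i).

Definition uniform_knot (a b : R) (N i : nat) : R :=
  a + INR i * ((b - a) / INR N).

Definition affine_on (a b : R) (g : R -> R) : Prop :=
  exists c d : R, forall t, a <= t <= b -> g t = c + d * t.

Definition is_pl_interpolant (a b : R) (N : nat) (x : nat -> R)
    (f g : R -> R) : Prop :=
  (forall t, a <= t <= b -> continue_in g (cint a b) t) /\
  (forall i, (i < N)%nat -> affine_on (x i) (x (S i)) g) /\
  (forall i, (i <= N)%nat -> g (x i) = f (x i)).

Lemma uniform_knot_partition (a b : R) (N : nat) :
  a < b -> (1 <= N)%nat -> is_partition a b N (uniform_knot a b N).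
Proof.
intros hab hN; unfold uniform_knot.
assert (hN' : 0 < INR N) by (apply lt_0_INR; lia).
split; [simpl; lra|split; [field; lra|]].
intros i _; rewrite S_INR.
assert (0 < (b - a) / INR N) by (apply Rdiv_lt_0_compat; lra).
nra.
Qed.

Lemma partition_le (a b : R) (N : nat) (x : nat -> R) :
  is_partition a b N x ->
  forall i j, (i <= j)%nat -> (j <= N)%nat -> x i <= x j.
Proof.
intros [_ [_ hx]] i j hij; induction hij as [|j hij IH]; intros hj; [lra|].
specialize (hx j ltac:(lia)); specialize (IH ltac:(lia)); lra.
Qed.

Fixpoint pl_interp (x : nat -> R) (f : R -> R) (n : nat) (t : R) : R :=
  match n with
  | O => f (x O)
  | S m => pl_interp x f m t +
      (f (x (S m)) - f (x m)) / (x (S m) - x m) *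
      (Rmin (Rmax t (x m)) (x (S m)) - x m)
  end.

Lemma pl_interp_lipschitz (x : nat -> R) (f : R -> R) (n : nat) :
  exists K, 0 <= K /\ forall s t,
    Rabs (pl_interp x f n s - pl_interp x f n t) <= K * Rabs (s - t).
Proof.
induction n as [|n [K [hK IH]]]; simpl.
- exists 0; split; [lra|]; intros s t; rewrite Rminus_diag, Rabs_R0; lra.
- set (k := (f (x (S n)) - f (x n)) / (x (S n) - x n)).
  exists (K + Rabs k); pose proof (Rabs_pos k); split; [lra|]; intros s t.
  set (c := fun u => Rmin (Rmax u (x n)) (x (S n)) - x n).
  fold (c s) (c t).
  replace (_ - _) with
    ((pl_interp x f n s - pl_interp x f n t) + k * (c s - c t)) by ring.
  eapply Rle_trans; [apply Rabs_triang|].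
  rewrite Rabs_mult, Rmult_plus_distr_r.
  apply Rplus_le_compat; [apply IH|].
  apply Rmult_le_compat_l; [lra|].
  unfold c, Rmin, Rmax; repeat destruct Rle_dec; split_Rabs; lra.
Qed.

Lemma pl_interp_right (a b : R) (N : nat) (x : nat -> R) (f : R -> R) :
  is_partition a b N x ->
  forall n t, (n <= N)%nat -> x n <= t -> pl_interp x f n t = f (x n).
Proof.
intros hx; induction n as [|n IH]; intros t hn ht; simpl; [reflexivity|].
assert (hlt : x n < x (S n)) by (apply hx; lia).
rewrite (IH t) by (lia || lra).
rewrite (Rmax_left t) by lra; rewrite Rmin_right by lra; field; lra.
Qed.

Lemma pl_interp_left (a b : R) (N : nat) (x : nat -> R) (f : R -> R) :
  is_partition a b N x ->
  forall k n t, (k + n <= N)%nat -> t <= x n ->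
    pl_interp x f (k + n) t = pl_interp x f n t.
Proof.
intros hx; induction k as [|k IH]; intros n t hn ht; simpl; [reflexivity|].
assert (hlt : x (k + n)%nat < x (S (k + n))) by (apply hx; lia).
assert (hle : x n <= x (k + n)%nat) by (apply (partition_le a b N x hx); lia).
rewrite (IH n t) by (lia || lra).
rewrite (Rmax_right t) by lra; rewrite Rmin_left by lra; ring.
Qed.

Lemma pl_interpolant_exists (a b : R) (N : nat) (x : nat -> R) (f : R -> R) :
  is_partition a b N x -> is_pl_interpolant a b N x f (pl_interp x f N).
Proof.
intros hx; split; [|split].
- intros t _ eps heps.
  destruct (pl_interp_lipschitz x f N) as [K [hK hlip]].
  exists (eps / (K + 1)); split; [apply Rdiv_lt_0_compat; lra|].
  intros s [_ hs]; simpl in *; unfold Rdist in *.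
  eapply Rle_lt_trans; [apply hlip|].
  pose proof (Rabs_pos (s - t)).
  apply (Rmult_lt_compat_r (K + 1)) in hs; [|lra].
  replace (eps / (K + 1) * (K + 1)) with eps in hs by (field; lra).
  nra.
- intros i hi.
  set (k := (f (x (S i)) - f (x i)) / (x (S i) - x i)).
  exists (f (x i) - k * x i), k; intros t ht.
  replace N with ((N - S i) + S i)%nat by lia.
  rewrite (pl_interp_left a b N x f hx) by (lia || lra); simpl.
  rewrite (pl_interp_right a b N x f hx) by (lia || lra).
  rewrite (Rmax_left t) by lra; rewrite Rmin_left by lra; fold k; ring.
- intros i hi.
  replace N with ((N - i) + i)%nat by lia.
  rewrite (pl_interp_left a b N x f hx) by (lia || lra).
  apply (pl_interp_right a b N x f hx); [lia|lra].
Qed.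

Lemma pl_interpolant_unique (a b : R) (N : nat) (x : nat -> R)
    (f g h : R -> R) :
  is_partition a b N x -> (1 <= N)%nat ->
  is_pl_interpolant a b N x f g -> is_pl_interpolant a b N x f h ->
  forall t, a <= t <= b -> g t = h t.
Proof.
intros [h0 [hN hx]] h1 [_ [ga gi]] [_ [ha hi]] t ht.
assert (H : forall n, (n <= N)%nat -> x 0%nat <= t -> t <= x n ->
  t = x 0%nat \/ exists i, (i < n)%nat /\ x i <= t <= x (S i)).
{ induction n as [|n IH]; intros hn l1 l2; [left; lra|].
  destruct (Rle_dec t (x n)) as [l3|l3].
  - destruct (IH ltac:(lia) l1 l3) as [e|[i [l4 l5]]]; [now left|].
    right; exists i; split; [lia|exact l5].
  - right; exists n; split; [lia|lra]. }
destruct (H N (le_n N)) as [->|[i [lin li]]]; try lra.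
{ rewrite gi, hi by lia; reflexivity. }
specialize (hx i lin).
destruct (ga i lin) as [c [d e1]]; destruct (ha i lin) as [c' [d' e2]].
pose proof (gi i ltac:(lia)) as g1; pose proof (gi (S i) ltac:(lia)) as g2.
pose proof (hi i ltac:(lia)) as k1; pose proof (hi (S i) ltac:(lia)) as k2.
rewrite e1 in g1, g2 by lra; rewrite e2 in k1, k2 by lra.
rewrite e1, e2 by lra.
assert (hd : (d - d') * (x (S i) - x i) = 0) by lra.
apply Rmult_integral in hd; destruct hd as [hd|hd]; [|lra].
assert (d = d') by lra; subst d'; lra.
Qed.

(* Main.v *)
Require Import Defs.
From Stdlib Require Import Reals Lra Lia.
From Coquelicot Require Import Coquelicot.
Open Scope R_scope.

(** On a cell [p, q] the error of linear interpolation at [t] equals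
    [f''(xi) / 2 * (t - p) * (t - q)] for some [xi] in the cell.  The integral
    of [((t - p) * (t - q)) ^ 2 / 4] over a cell of length [h] is [h ^ 5 / 120],
    so by uniform continuity of [f'' ^ 2] the squared error integrates over the
    cell to [h ^ 4 / 120] times the integral of [f'' ^ 2], up to [o(h ^ 5)].
    Summing over [N] cells of length [(b - a) / N] and multiplying by [N ^ 4]
    gives the limit of the squared norms. *)

(** * Clamping to an interval and continuity within it *)

(** Composing with [clamp] extends a function on [a, b] by its end values. Continuity within [a, b]
    then becomes ordinary continuity on the whole line, the form in which Heine's and Rolle's
    theorems and the integrability criterion apply. *)
Definition clamp (a b t : R) : R := Rmin (Rmax t a) b.

Lemma clamp_in (a b t : R) : a <= b -> a <= clamp a b t <= b.
Proof.
intros hab; unfold clamp, Rmin, Rmax; repeat destruct Rle_dec; lra.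
Qed.

Lemma clamp_id (a b t : R) : a <= t <= b -> clamp a b t = t.
Proof.
intros ht; unfold clamp, Rmin, Rmax; repeat destruct Rle_dec; lra.
Qed.

Lemma clamp_contract (a b s t : R) :
  Rabs (clamp a b s - clamp a b t) <= Rabs (s - t).
Proof.
unfold clamp, Rmin, Rmax; repeat destruct Rle_dec; split_Rabs; lra.
Qed.

Lemma continuity_pt_clamp (a b : R) (u : R -> R) :
  a <= b -> (forall t, a <= t <= b -> continue_in u (cint a b) t) ->
  forall x, continuity_pt (fun t => u (clamp a b t)) x.
Proof.
intros hab hu x eps heps.
destruct (hu _ (clamp_in a b x hab) eps heps) as [del [hdel H]].
exists del; split; [exact hdel|]; intros t [_ ht].
simpl in *; unfold Rdist in *.
(* [continue_in] speaks only of points distinct from the limit point, but clamping may send [t] and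
   [x] to the same point. *)
destruct (Req_dec (clamp a b x) (clamp a b t)) as [e|ne].
- rewrite e, Rminus_diag, Rabs_R0; exact heps.
- apply H; split.
  + split; [apply clamp_in, hab|exact ne].
  + eapply Rle_lt_trans; [apply clamp_contract|exact ht].
Qed.

Lemma ex_RInt_continue_in (a b : R) (u : R -> R) :
  (forall t, a <= t <= b -> continue_in u (cint a b) t) ->
  forall p q, a <= p -> p <= q -> q <= b -> ex_RInt u p q.
Proof.
intros hu p q hp hpq hq.
apply (ex_RInt_ext (fun t => u (clamp a b t))).
- rewrite Rmin_left, Rmax_right by lra; intros t ht.
  rewrite clamp_id by lra; reflexivity.
- apply (@ex_RInt_continuous R_CompleteNormedModule); intros t _.
  apply continuity_pt_filterlim, continuity_pt_clamp; [lra|exact hu].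
Qed.

Lemma unif_continuous_continue_in (a b : R) (u : R -> R) :
  a <= b -> (forall t, a <= t <= b -> continue_in u (cint a b) t) ->
  forall eps, 0 < eps -> exists del, 0 < del /\
    forall s t, a <= s <= b -> a <= t <= b -> Rabs (s - t) < del ->
      Rabs (u s - u t) < eps.
Proof.
intros hab hu eps heps.
destruct (@Heine_cor2 (fun t => u (clamp a b t)) a b
  (fun x _ => continuity_pt_clamp a b u hab hu x) (mkposreal eps heps))
  as [del H].
exists del; split; [apply cond_pos|]; intros s t hs ht hst.
specialize (H s t hs ht hst); simpl in H.
rewrite !clamp_id in H by assumption; exact H.
Qed.

Lemma continue_in_mult (D : R -> Prop) (u v : R -> R) (x : R) :
  continue_in u D x -> continue_in v D x ->
  continue_in (fun t => u t * v t) D x.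
Proof. intros hu hv; apply limit_mul; assumption. Qed.

Lemma continue_in_minus (D : R -> Prop) (u v : R -> R) (x : R) :
  continue_in u D x -> continue_in v D x ->
  continue_in (fun t => u t - v t) D x.
Proof. intros hu hv; apply limit_minus; assumption. Qed.

Lemma continue_in_pow2 (D : R -> Prop) (u : R -> R) (x : R) :
  continue_in u D x -> continue_in (fun t => u t ^ 2) D x.
Proof.
intros hu; simpl; apply continue_in_mult; [exact hu|].
apply continue_in_mult; [exact hu|].
(* The square unfolds to [u t * (u t * 1)]; the constant factor 1 remains. *)
apply (limit_free (fun _ => 1) (D_x D x) x x).
Qed.

(** * Pointwise error of linear interpolation *)

Lemma derivable_pt_lim_D_in (a b : R) (u u' : R -> R) (x : R) :
  a < x < b -> D_in u u' (cint a b) x -> derivable_pt_lim u x (u' x).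
Proof.
intros hx H eps heps.
destruct (H eps heps) as [del [hdel Hd]]; simpl in Hd; unfold Rdist in Hd.
(* This radius also keeps [x + h] inside [a, b], where the limit within the interval says
   something. *)
assert (hm : 0 < Rmin del (Rmin (x - a) (b - x))).
{ repeat apply Rmin_pos; lra. }
exists (mkposreal _ hm); simpl; intros h hne hh.
pose proof (Rmin_l del (Rmin (x - a) (b - x))).
pose proof (Rmin_r del (Rmin (x - a) (b - x))).
pose proof (Rmin_l (x - a) (b - x)); pose proof (Rmin_r (x - a) (b - x)).
specialize (Hd (x + h)); replace (x + h - x) with h in Hd by ring.
apply Hd; split; [|lra]; split; [|lra].
unfold cint; split_Rabs; lra.
Qed.

Lemma derivable_pt_lim_ext_open (a b : R) (u v : R -> R) (x l : R) :
  a < x < b -> (forall t, a < t < b -> u t = v t) ->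
  derivable_pt_lim u x l -> derivable_pt_lim v x l.
Proof.
intros hx huv hu; apply is_derive_Reals; apply is_derive_Reals in hu.
apply (is_derive_ext_loc u); [|exact hu].
assert (hm : 0 < Rmin (x - a) (b - x)) by (apply Rmin_pos; lra).
exists (mkposreal _ hm); intros t ht.
unfold ball in ht; simpl in ht; unfold AbsRing_ball, abs, minus, plus, opp in ht;
simpl in ht.
pose proof (Rmin_l (x - a) (b - x)); pose proof (Rmin_r (x - a) (b - x)).
apply huv; split_Rabs; lra.
Qed.

(** Giving the derivative as a function [u'] makes the zero one of [u'], instead of a term that
    depends on a derivability proof; the second use of Rolle can then start from it. *)
Lemma Rolle_lim (u u' : R -> R) (a b : R) :
  a < b -> u a = u b ->
  (forall x, a < x < b -> derivable_pt_lim u x (u' x)) ->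
  (forall x, a <= x <= b -> continuity_pt u x) ->
  exists c, a < c < b /\ u' c = 0.
Proof.
intros hab huab hd hc.
destruct (Rolle u a b (fun x hx => exist _ (u' x) (hd x hx)) hc hab huab)
  as [c [hcab H]].
exists c; split; [exact hcab|exact H].
Qed.

(* Rolle's theorem twice, applied to [f - g - K (s - p) (s - q)] with [K]
   chosen to make this function vanish at [t] as well as at [p] and [q]. *)
Lemma interpolation_error (a b : R) (f f1 f2 g : R -> R) (p q : R) :
  C2_on a b f f1 f2 -> a <= p -> p < q -> q <= b ->
  affine_on p q g -> g p = f p -> g q = f q ->
  forall t, p <= t <= q ->
    exists xi, p <= xi <= q /\ f t - g t = f2 xi / 2 * ((t - p) * (t - q)).
Proof.
intros hC hap hpq hqb [c [d hg]] hgp hgq t ht.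
(* At an endpoint both sides vanish, and the quotient [K] below would have denominator zero. *)
destruct (Req_dec t p) as [->|ntp].
{ exists p; split; [lra|rewrite hgp; field]. }
destruct (Req_dec t q) as [->|ntq].
{ exists q; split; [lra|rewrite hgq; field]. }
rewrite hg in hgp, hgq by lra.
set (K := (f t - g t) / ((t - p) * (t - q))).
assert (hK : f t - g t = K * ((t - p) * (t - q))) by (unfold K; field; lra).
set (P := fun s => c + d * s + K * ((s - p) * (s - q))).
set (P' := fun s => d + K * (2 * s - p - q)).
assert (hP : forall s, derivable_pt_lim P s (P' s)).
{ intros s; apply is_derive_Reals; unfold P, P'; auto_derive; [exact I|ring]. }
assert (hP' : forall s, derivable_pt_lim P' s (2 * K)).
{ intros s; apply is_derive_Reals; unfold P'; auto_derive; [exact I|ring]. }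
(* The cell may touch [a] or [b], where [f] is only continuous from one side; clamping makes [phi]
   continuous there without changing it on [a, b]. *)
set (phi := fun s => f (clamp a b s) - P s).
assert (hfc : forall s, a <= s <= b -> continue_in f (cint a b) s).
{ intros s hs; apply cont_deriv with f1; apply (hC s hs). }
assert (hphid : forall s, p < s < q -> derivable_pt_lim phi s (f1 s - P' s)).
{ intros s hs.
  apply (derivable_pt_lim_minus (fun s => f (clamp a b s)) P); [|apply hP].
  apply (derivable_pt_lim_ext_open a b f); [lra| |].
  - intros r hr; rewrite clamp_id by lra; reflexivity.
  - apply (derivable_pt_lim_D_in a b); [lra|apply hC; lra]. }
assert (hphic : forall s, continuity_pt phi s).
{ intros s; apply (continuity_pt_minus (fun s => f (clamp a b s)) P).
  - apply continuity_pt_clamp; [lra|exact hfc].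
  - apply derivable_continuous_pt; exists (P' s); apply hP. }
assert (vp : phi p = 0).
{ unfold phi, P; rewrite clamp_id by lra; rewrite <- hgp; ring. }
assert (vq : phi q = 0).
{ unfold phi, P; rewrite clamp_id by lra; rewrite <- hgq; ring. }
assert (vt : phi t = 0).
{ unfold phi, P; rewrite clamp_id by lra; rewrite <- hK, <- hg by lra; ring. }
destruct (Rolle_lim phi (fun s => f1 s - P' s) p t) as [c1 [h1 e1]];
  [lra|lra|intros; apply hphid; lra|intros; apply hphic|].
destruct (Rolle_lim phi (fun s => f1 s - P' s) t q) as [c2 [h2 e2]];
  [lra|lra|intros; apply hphid; lra|intros; apply hphic|].
assert (hd2 : forall s, p < s < q ->
  derivable_pt_lim (fun s => f1 s - P' s) s (f2 s - 2 * K)).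
{ intros s hs; apply (derivable_pt_lim_minus f1 P'); [|apply hP'].
  apply (derivable_pt_lim_D_in a b); [lra|apply hC; lra]. }
(* Both zeros [c1 < t < c2] are interior to the cell, so [f1] has a two-sided derivative on [c1, c2]
   and is used unclamped. A zero of [f2 - 2 K] is the required point. *)
destruct (Rolle_lim (fun s => f1 s - P' s) (fun s => f2 s - 2 * K) c1 c2)
  as [xi [hxi e]]; [lra|lra|intros; apply hd2; lra| |].
{ intros s hs; apply derivable_continuous_pt; eexists; apply hd2; lra. }
exists xi; split; [lra|].
rewrite hK; replace (f2 xi / 2) with K by lra; reflexivity.
Qed.

(** * Integral of the squared error over one cell *)

Lemma is_RInt_bubble_sqr (p q k : R) :
  is_RInt (fun t => ((t - p) * (t - q)) ^ 2 / 4 * k) p q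
    ((q - p) ^ 5 / 120 * k).
Proof.
(* With s = t - p and h = q - p the integrand is k / 4 times h^2 s^2 - 2 h s^3 + s^4; [G] integrates
   it term by term, and (1/3 - 1/2 + 1/5) / 4 = 1/120. *)
set (G := fun t => k / 4 * ((q - p) ^ 2 * (t - p) ^ 3 / 3
  - (q - p) * (t - p) ^ 4 / 2 + (t - p) ^ 5 / 5)).
replace ((q - p) ^ 5 / 120 * k) with (minus (G q) (G p)).
2:{ unfold G, minus, plus, opp; simpl; field. }
apply (is_RInt_derive G).
- intros t _; unfold G; auto_derive; [exact I|field].
- intros t _; apply continuity_pt_filterlim, derivable_continuous_pt; reg.
Qed.

(** Since [F] stays within [eps] of [F p], both compared quantities lie within
    [eps * (q - p) ^ 5 / 120] of [F p * (q - p) ^ 5 / 120], whence the factor 2. Bounding [F xi]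
    pointwise avoids integrating it as a function of [t], on which [xi] depends in an unknown
    way. *)
Lemma cell_estimate (p q eps : R) (E F : R -> R) :
  p <= q -> ex_RInt E p q -> ex_RInt F p q ->
  (forall s t, p <= s <= q -> p <= t <= q -> Rabs (F s - F t) <= eps) ->
  (forall t, p <= t <= q -> exists xi, p <= xi <= q /\
     E t = ((t - p) * (t - q)) ^ 2 / 4 * F xi) ->
  Rabs (RInt E p q - (q - p) ^ 4 / 120 * RInt F p q) <=
    2 * eps * ((q - p) ^ 5 / 120).
Proof.
intros hpq hE hF hosc hxi.
pose proof (is_RInt_bubble_sqr p q (F p + eps)) as Iu.
pose proof (is_RInt_bubble_sqr p q (F p - eps)) as Il.
assert (bd : forall t, p <= t <= q -> F p - eps <= F t <= F p + eps).
{ intros t ht; specialize (hosc t p ht ltac:(lra)); split_Rabs; lra. }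
assert (Eu : RInt E p q <= (q - p) ^ 5 / 120 * (F p + eps)).
{ rewrite <- (is_RInt_unique _ _ _ _ Iu).
  apply RInt_le; [exact hpq|exact hE|eexists; exact Iu|]; intros t ht.
  destruct (hxi t ltac:(lra)) as [xi [h ->]].
  pose proof (pow2_ge_0 ((t - p) * (t - q))).
  apply Rmult_le_compat_l; [lra|apply bd, h]. }
assert (El : (q - p) ^ 5 / 120 * (F p - eps) <= RInt E p q).
{ rewrite <- (is_RInt_unique _ _ _ _ Il).
  apply RInt_le; [exact hpq|eexists; exact Il|exact hE|]; intros t ht.
  destruct (hxi t ltac:(lra)) as [xi [h ->]].
  pose proof (pow2_ge_0 ((t - p) * (t - q))).
  apply Rmult_le_compat_l; [lra|apply bd, h]. }
assert (hconst : forall k : R, RInt (fun _ => k) p q = (q - p) * k).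
{ intros k; apply (@RInt_const R_CompleteNormedModule). }
assert (Fu : RInt F p q <= (q - p) * (F p + eps)).
{ rewrite <- hconst.
  apply RInt_le; [exact hpq|exact hF|apply ex_RInt_const|].
  intros t ht; apply bd; lra. }
assert (Fl : (q - p) * (F p - eps) <= RInt F p q).
{ rewrite <- hconst.
  apply RInt_le; [exact hpq|apply ex_RInt_const|exact hF|].
  intros t ht; apply bd; lra. }
assert (h4 : 0 <= (q - p) ^ 4 / 120) by (pose proof (pow_le (q - p) 4); lra).
apply (Rmult_le_compat_l _ _ _ h4) in Fu, Fl.
replace ((q - p) ^ 5 / 120) with ((q - p) ^ 4 / 120 * (q - p)) in * by field.
apply Rabs_le; lra.
Qed.

(** * Summation over the cells *)

Lemma sum_cell_estimates (x : nat -> R) (E F : R -> R) (N : nat) (C B : R) :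
  (forall i j, (i <= j)%nat -> (j <= N)%nat ->
     ex_RInt E (x i) (x j) /\ ex_RInt F (x i) (x j)) ->
  (forall i, (i < N)%nat ->
     Rabs (RInt E (x i) (x (S i)) - C * RInt F (x i) (x (S i))) <= B) ->
  Rabs (RInt E (x 0%nat) (x N) - C * RInt F (x 0%nat) (x N)) <= INR N * B.
Proof.
intros hex hcell.
assert (H : forall n, (n <= N)%nat ->
  Rabs (RInt E (x 0%nat) (x n) - C * RInt F (x 0%nat) (x n)) <= INR n * B).
{ induction n as [|n IH]; intros hn.
  - rewrite !RInt_point; unfold zero; simpl.
    rewrite Rmult_0_r, Rminus_diag, Rabs_R0; lra.
  - destruct (hex 0%nat n ltac:(lia) ltac:(lia)) as [e1 e2].
    destruct (hex n (S n) ltac:(lia) ltac:(lia)) as [e3 e4].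
    rewrite <- (RInt_Chasles E _ _ _ e1 e3), <- (RInt_Chasles F _ _ _ e2 e4).
    specialize (IH ltac:(lia)); specialize (hcell n ltac:(lia)).
    rewrite S_INR; unfold plus; simpl; split_Rabs; lra. }
apply H; lia.
Qed.

(** With h = (b - a) / N, the N cell errors of size [2 * eps * h ^ 5 / 120], multiplied by N^4,
    carry the factor (N h)^5 = (b - a)^5, so the bound depends on N only through [eps]. *)
Lemma uniform_sqr_error_estimate
    (a b : R) (f f1 f2 g : R -> R) (N : nat) (eps : R) :
  a < b -> (1 <= N)%nat -> C2_on a b f f1 f2 ->
  is_pl_interpolant a b N (uniform_knot a b N) f g ->
  (forall s t, a <= s <= b -> a <= t <= b -> Rabs (s - t) <= (b - a) / INR N ->
     Rabs (f2 s ^ 2 - f2 t ^ 2) <= eps) ->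
  Rabs (INR N ^ 4 * RInt (fun t => (f t - g t) ^ 2) a b
        - (b - a) ^ 4 / 120 * RInt (fun t => f2 t ^ 2) a b)
    <= 2 * eps * ((b - a) ^ 5 / 120).
Proof.
intros hab hN hC [hgc [hga hgi]] hosc.
pose proof (uniform_knot_partition a b N hab hN) as hpart.
set (h := (b - a) / INR N) in *; set (x := uniform_knot a b N) in *.
pose proof (partition_le a b N x hpart) as hle.
destruct hpart as [h0 [hNb hlt]].
assert (hN0 : 0 < INR N) by (apply lt_0_INR; lia).
assert (hh : 0 < h) by (apply Rdiv_lt_0_compat; lra).
assert (hstep : forall i, x (S i) - x i = h).
{ intros i; unfold x, uniform_knot; fold h; rewrite S_INR; ring. }
assert (hin : forall i, (i <= N)%nat -> a <= x i <= b).
{ intros i hi; rewrite <- h0 at 1; rewrite <- hNb; split; apply hle; lia. }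
set (E := fun t => (f t - g t) ^ 2); set (F := fun t => f2 t ^ 2).
assert (hEc : forall t, a <= t <= b -> continue_in E (cint a b) t).
{ intros t ht; apply continue_in_pow2, continue_in_minus; [|apply hgc, ht].
  apply cont_deriv with f1; apply (hC t ht). }
assert (hFc : forall t, a <= t <= b -> continue_in F (cint a b) t).
{ intros t ht; apply continue_in_pow2, (hC t ht). }
assert (hex : forall i j, (i <= j)%nat -> (j <= N)%nat ->
  ex_RInt E (x i) (x j) /\ ex_RInt F (x i) (x j)).
{ intros i j hij hj.
  pose proof (hin i ltac:(lia)); pose proof (hin j hj).
  pose proof (hle i j hij hj).
  split; apply (ex_RInt_continue_in a b); assumption || lra. }
assert (hsum : Rabs (RInt E (x 0%nat) (x N)
    - h ^ 4 / 120 * RInt F (x 0%nat) (x N))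
  <= INR N * (2 * eps * (h ^ 5 / 120))).
{ apply sum_cell_estimates; [exact hex|].
  intros i hi; rewrite <- (hstep i).
  pose proof (hin i ltac:(lia)); pose proof (hin (S i) hi).
  pose proof (hlt i hi); pose proof (hstep i).
  apply cell_estimate; [lra|apply hex; lia|apply hex; lia| |].
  - intros s t hs ht; apply hosc; try lra; split_Rabs; lra.
  - intros t ht.
    destruct (interpolation_error a b f f1 f2 g (x i) (x (S i)) hC)
      with (t := t) as [xi [hxi e]]; try lra.
    + apply hga, hi.
    + apply hgi; lia.
    + apply hgi; lia.
    + exists xi; split; [exact hxi|]; unfold E, F; rewrite e; field. }
rewrite h0, hNb in hsum.
assert (hb : b - a = INR N * h) by (unfold h; field; lra).
assert (hN4 : 0 <= INR N ^ 4) by (apply pow_le; lra).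
apply (Rmult_le_compat_l _ _ _ hN4) in hsum.
rewrite <- (Rabs_pos_eq _ hN4), <- Rabs_mult, (Rabs_pos_eq _ hN4) in hsum.
rewrite hb; fold E F.
replace (INR N ^ 4 * RInt E a b - (INR N * h) ^ 4 / 120 * RInt F a b)
  with (INR N ^ 4 * (RInt E a b - h ^ 4 / 120 * RInt F a b)) by field.
replace (2 * eps * ((INR N * h) ^ 5 / 120))
  with (INR N ^ 4 * (INR N * (2 * eps * (h ^ 5 / 120)))) by field.
exact hsum.
Qed.

(** * Passage to the limit *)

Lemma is_lim_seq_uniform_sqr_error
    (a b : R) (f f1 f2 : R -> R) (g : nat -> R -> R) :
  a < b -> C2_on a b f f1 f2 ->
  (forall N : nat, (1 <= N)%nat ->
     is_pl_interpolant a b N (uniform_knot a b N) f (g N)) ->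
  is_lim_seq
    (fun N => INR N ^ 4 * RInt (fun t => (f t - g N t) ^ 2) a b)
    ((b - a) ^ 4 / 120 * RInt (fun t => f2 t ^ 2) a b).
Proof.
intros hab hC hg; apply is_lim_seq_spec; intros [eps heps]; simpl.
assert (h5 : 0 < (b - a) ^ 5 / 120).
{ apply Rdiv_lt_0_compat; [apply pow_lt; lra|lra]. }
set (D := (b - a) ^ 5 / 120) in *.
(* With this oscillation the estimate yields [2 * (eps / (4 * D)) * D = eps / 2], strictly below
   [eps]. *)
assert (heta : 0 < eps / (4 * D)) by (apply Rdiv_lt_0_compat; lra).
destruct (unif_continuous_continue_in a b (fun t => f2 t ^ 2) ltac:(lra))
  with (eps := eps / (4 * D)) as [del [hdel H]]; [|exact heta|].
{ intros t ht; apply continue_in_pow2, (hC t ht). }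
destruct (INR_archimed del (b - a) hdel) as [M hM].
(* From [S M] on, the mesh is below [del], and N is at least 1, as the interpolation hypothesis
   demands. *)
exists (S M); intros N hN.
assert (hMN : INR M < INR N) by (apply lt_INR; lia).
assert (hN0 : 0 < INR N) by (apply lt_0_INR; lia).
assert (hmesh : (b - a) / INR N < del).
{ apply (Rmult_lt_reg_r (INR N)); [exact hN0|].
  replace ((b - a) / INR N * INR N) with (b - a) by (field; lra).
  nra. }
eapply Rle_lt_trans.
- apply (uniform_sqr_error_estimate a b f f1 f2 (g N) N (eps / (4 * D)));
    [exact hab|lia|exact hC|apply hg; lia|].
  intros s t hs ht hst; apply Rlt_le, H; [exact hs|exact ht|lra].
- fold D; replace (2 * (eps / (4 * D)) * D) with (eps / 2) by (field; lra); lra.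
Qed.

Theorem mainTheorem6 :
  forall (a b : R) (f f1 f2 : R -> R) (g : nat -> R -> R),
    a < b ->
    C2_on a b f f1 f2 ->
    (forall N : nat, (1 <= N)%nat ->
       is_pl_interpolant a b N (uniform_knot a b N) f (g N)) ->
    is_lim_seq
      (fun N : nat => INR N ^ 2 * L2norm a b (fun x => f x - g N x))
      (Finite ((b - a) ^ 2 / sqrt 120 * L2norm a b f2)).
Proof.
intros a b f f1 f2 g hab hC hg.
pose proof (is_lim_seq_uniform_sqr_error a b f f1 f2 g hab hC hg) as H.
(* [sqrt] is continuous at 0 too, so a vanishing limit needs no separate case. *)
apply (is_lim_seq_continuous sqrt) in H.
2:{ apply continuity_pt_filterlim, continuous_sqrt. }
assert (hsq : forall r, 0 <= r -> sqrt (r ^ 4) = r ^ 2).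
{ intros r hr; replace (r ^ 4) with ((r ^ 2) ^ 2) by ring.
  apply sqrt_pow2, pow2_ge_0. }
unfold L2norm.
replace ((b - a) ^ 2 / sqrt 120 * sqrt (RInt (fun x => f2 x ^ 2) a b))
  with (sqrt ((b - a) ^ 4 / 120 * RInt (fun t => f2 t ^ 2) a b)).
- eapply is_lim_seq_ext; [|exact H]; intros N; cbv beta.
  pose proof (pos_INR N).
  rewrite sqrt_mult_alt by (apply pow_le; lra); rewrite hsq by lra.
  reflexivity.
- rewrite sqrt_mult_alt, sqrt_div_alt, hsq by
    (try (apply Rdiv_le_0_compat; [apply pow_le|]); lra).
  reflexivity.
Qed.
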